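(* Let $S$ be a bounded operator on $L^2(\mathbb{R}^d)$ and let $Q_S$ be the Cohen's class distribution determined by $Q_S(\psi)=(\psi\otimes\psi)\star S$ for $\psi\in L^2(\mathbb{R}^d)$. If $\Omega\subset\mathbb{R}^{2d}$ is a measurable subset such that $$\iint_\Omega|Q_S(\psi)|\,dz\ \ge\ (1-\epsilon)\|S\|_{B(L^2(\mathbb{R}^d))}$$ for some $\psi\in L^2(\mathbb{R}^d)$ with $\|\psi\|_{L^2}=1$ and $\epsilon\ge0$, then $\mu(\Omega)\ge1-\epsilon$.
   Context: $\mu$ is Lebesgue measure on $\mathbb{R}^{2d}$; $\|\cdot\|_{B(L^2(\mathbb{R}^d))}$ is the operator norm. For $z=(x,\omega)\in\mathbb{R}^{2d}$, $\pi(z)\psi(t)=e^{2\pi i\omega\cdot t}\psi(t-x)$, $\alpha_z(A)=\pi(z)A\pi(z)^*$; $P\psi(x)=\psi(-x)$, $\check A=PAP$; $(\psi\otimes\psi)\zeta=\langle\zeta,\psi\rangle\psi$. For a trace class operator $R$ and a bounded operator $T$, $R\star T(z)=\mathrm{tr}(R\,\alpha_z(\check T))$; thus $((\psi\otimes\psi)\star S)(z)=\langle\check S\pi(z)^*\psi,\pi(z)^*\psi\rangle$.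
   Formalization: The operator S is assumed to be nonzero: for S = 0, Ω empty and ε = 0 the concentration hypothesis reads 0 ≥ 0 while the conclusion would read 0 ≥ 1; also d ≥ 1 is assumed. *)

(* Defs.v *)
From HB Require Import structures.
From mathcomp Require Import all_boot all_order all_algebra.
From mathcomp Require Import complex ring_quotient.
From mathcomp Require Import all_classical all_reals all_analysis.
From mathcomp Require Import measurable_realfun.
From mathcomp Require Import lra.

Set Implicit Arguments.
Unset Strict Implicit.
Unset Printing Implicit Defensive.

Import Order.TTheory GRing.Theory Num.Theory.
Import numFieldNormedType.Exports.

Local Open Scope classical_set_scope.
Local Open Scope ring_scope.

Section lebesgue_rn.
Context {R : realType}.

(* [Some (a, b)] is the closed box \prod_i [a_i, b_i], empty as soon as
   b_i < a_i for some i. [None] is the empty box: it makes finite covers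
   available even when n = 0, where every closed box is the whole space. *)
Definition box n : Type := option ('rV[R]_n * 'rV[R]_n).

Definition box_set n (B : box n) : set 'rV[R]_n :=
  if B is Some (a, b) then
    [set x | forall i, a ord0 i <= x ord0 i <= b ord0 i]
  else set0.

Definition box_vol n (B : box n) : R :=
  if B is Some (a, b) then \prod_(i < n) Num.max 0 (b ord0 i - a ord0 i)
  else 0.

Definition lebesgue_outer n (A : set 'rV[R]_n) : \bar R :=
  ereal_inf [set (\sum_(k <oo) (box_vol (F k))%:E)%E
            | F in [set F : nat -> box n | A `<=` \bigcup_k box_set (F k)]].

Lemma box_vol_ge0 n (B : box n) : 0 <= box_vol B.
Proof.
by case: B => [[a b]|]//=; apply: prodr_ge0 => i _; rewrite le_max lexx.
Qed.

Section outer.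
Variable n : nat.
Local Open Scope ereal_scope.
Let vol (B : box n) := (box_vol B)%:E.
Let vol_ge0 B : 0 <= vol B. Proof. by rewrite lee_fin box_vol_ge0. Qed.
Local Notation lo := (@lebesgue_outer n).

Let lo_ge0 A : 0 <= lo A.
Proof.
by apply: le_ereal_inf_tmp => _ [F _ <-]; apply: nneseries_ge0 => k _ _; exact: vol_ge0.
Qed.

Let lo0 : lo set0 = 0.
Proof.
apply/eqP; rewrite eq_le lo_ge0 andbT; apply: ereal_inf_lbound.
by exists (fun=> None) => //=; rewrite eseries0.
Qed.

Let le_lo : {homo lo : A B / A `<=` B >-> A <= B}.
Proof.
move=> A B AB; apply: ereal_inf_le_tmp => _ [F BF <-]; exists F => //.
exact: subset_trans BF.
Qed.

Let lo_sigma_subadditive : sigma_subadditive lo.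
Proof.
move=> A; have [[i ioo]|] := pselect (exists i, lo (A i) = +oo).
  rewrite (eseries_pinfty _ _ ioo) ?leey// => k _.
  by rewrite -ltNye (lt_le_trans _ (lo_ge0 _)).
rewrite -forallNE => Aoo.
suff add2e (e : {posnum R}) :
    lo (\bigcup_n A n) <= \sum_(i <oo) lo (A i) + e%:num%:E.
  by apply/lee_addgt0Pr => _/posnumP[].
rewrite (le_trans _ (epsilon_trick _ _ _))//.
pose P m (B : nat -> box n) := A m `<=` \bigcup_k box_set (B k) /\
  \sum_(k <oo) vol (B k) <= lo (A m) + (e%:num / (2 ^ m.+1)%:R)%:E.
have [G PG] : {G : nat -> nat -> box n & forall m, P m (G m)}.
  apply: (@choice _ _ P) => m; rewrite /P /lebesgue_outer.
  set S := (X in ereal_inf X); move infS : (ereal_inf S) => iS.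
  case: iS infS => [r Sr|Soo|Soo].
  - have en1 : (0 < e%:num / (2 ^ m.+1)%:R)%R by [].
    have /(lb_ereal_inf_adherent en1) : ereal_inf S \is a fin_num by rewrite Sr.
    move=> [x [B AnB muBx] xS].
    by exists B; split => //; rewrite muBx -Sr; exact/ltW.
  - by have := Aoo m; rewrite /lebesgue_outer Soo.
  - suff : lbound S 0 by move/le_ereal_inf_tmp; rewrite Soo.
    by move=> /= _ [B AnB <-]; apply: nneseries_ge0 => k _ _; exact: vol_ge0.
have muG_ge0 x : 0 <= (vol \o uncurry G) x by exact: vol_ge0.
apply: (@le_trans _ _ (\esum_(i in setT) (vol \o uncurry G) i)).
  rewrite /lebesgue_outer; apply: ereal_inf_lbound => /=.
  have /card_esym/ppcard_eqP[f] := card_nat2.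
  exists (uncurry G \o f).
    apply: (@subset_trans _ (\bigcup_m \bigcup_k box_set (G m k))) => [t [i _]|].
      by move=> /((PG i).1) -[j _ ?]; exists i => //; exists j.
    move=> t [i _ [j _ Bijt]]; exists (f^-1%FUN (i, j)) => //=.
    by rewrite invK ?inE.
  rewrite -(esum_pred_image (vol \o uncurry G) _ xpredT) ?[fun=> _]set_true//.
  by rewrite image_eq.
rewrite (_ : esum _ _ = \sum_(i <oo) \sum_(j <oo ) vol (G i j)); last first.
  pose J : nat -> set (nat * nat) := fun i => [set (i, j) | j in setT].
  rewrite (_ : setT = \bigcup_k J k); last first.
    by rewrite predeqE => -[a b]; split => // _; exists a => //; exists b.
  rewrite esum_bigcupT /=; last 2 first.
    - apply/trivIsetP => i j _ _ ij.
      rewrite predeqE => -[p m] /=; split => //= -[] [_] _ [<-{p} _].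
      by move=> [m' _] [] /esym/eqP; rewrite (negbTE ij).
    - by move=> /= [p m]; exact: vol_ge0.
  rewrite -(image_id [set: nat]) -fun_true esum_pred_image//; last first.
    by move=> p _; exact: esum_ge0.
  apply: eq_eseriesr => /= j _.
  rewrite -(esum_pred_image (vol \o uncurry G) (pair j) predT)//=; last first.
    by move=> ? ? _ _; exact: (@can_inj _ _ _ snd).
  by congr esum; rewrite predeqE => -[a b]; split; move=> [i _ <-]; exists i.
apply: lee_lim.
- apply: is_cvg_nneseries => p *.
  by apply: nneseries_ge0 => m *; exact: (muG_ge0 (p, m)).
- by apply: is_cvg_nneseries => p *; apply: adde_ge0.
- by near=> p; apply: lee_sum => i _; exact: (PG i).2.
Unshelve. all: by end_near. Qed.

HB.instance Definition _ := isOuterMeasure.Build R 'rV[R]_n lo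
  lo0 lo_ge0 le_lo lo_sigma_subadditive.

End outer.

(* R^n with the sigma-algebra of Lebesgue measurable sets
   (Caratheodory's criterion). *)
Definition euclid n : Type := caratheodory_type (@lebesgue_outer n).
HB.instance Definition _ n := Measurable.on (euclid n).

Definition lebesgue n : set (euclid n) -> \bar R := @lebesgue_outer n.

Section lebesgue_measure.
Variable n : nat.
Let lo : {outer_measure set 'rV[R]_n -> \bar R} := @lebesgue_outer n.

Let lebesgue0 : lebesgue (set0 : set (euclid n)) = 0%E.
Proof. exact: (caratheodory_measure0 lo). Qed.

Let lebesgue_ge0 (A : set (euclid n)) : (0 <= lebesgue A)%E.
Proof. exact: (caratheodory_measure_ge0 (mu := lo)). Qed.

Let lebesgue_sigma_additive : semi_sigma_additive (@lebesgue n).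
Proof. exact: (@caratheodory_measure_sigma_additive _ _ lo). Qed.

HB.instance Definition _ := isMeasure.Build _ (euclid n) R (@lebesgue n)
  lebesgue0 lebesgue_ge0 lebesgue_sigma_additive.

End lebesgue_measure.

End lebesgue_rn.
Arguments euclid R n : clear implicits.
Arguments lebesgue R n : clear implicits.

Section lebesgue_rn_theory.
Context {R : realType} (n : nat).
Local Notation lo := (@lebesgue_outer R n).
Local Notation V := 'rV[R]_n.
Local Notation box := (@box R).

Lemma le_lebesgue_preimage (phi : V -> V) (g : box n -> box n) :
  (forall B, phi @^-1` (box_set B) `<=` box_set (g B)) ->
  (forall B, box_vol (g B) = box_vol B) ->
  forall A, (lo (phi @^-1` A) <= lo A)%E.
Proof.
move=> pg vg A; apply: le_ereal_inf_tmp => _ [F AF <-]; apply: ereal_inf_lbound.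
exists (g \o F); last by apply: eq_eseriesr => k _; rewrite /= vg.
by move=> x /= /AF [k _ Fx]; exists k => //; exact: pg.
Qed.

Definition box_shift (x : V) (B : box n) : box n :=
  omap (fun ab => (ab.1 + x, ab.2 + x)) B.
Definition box_opp (B : box n) : box n := omap (fun ab => (- ab.2, - ab.1)) B.

Lemma lebesgue_shift (x : V) (A : set V) :
  lo ((fun t => t - x) @^-1` A) = lo A.
Proof.
have H (y : V) (B : set V) : (lo ((fun t => (t - y)%R) @^-1` B) <= lo B)%E.
  apply: (le_lebesgue_preimage (g := box_shift y)) => -[[a b]|]//=.
    by move=> t /= ab i; move: (ab i); rewrite !mxE lerBrDr lerBlDr.
  by apply: eq_bigr => i _; rewrite !mxE opprD addrACA subrr addr0.
apply/eqP; rewrite eq_le H /=.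
have := H (- x) ((fun t => t - x) @^-1` A).
by rewrite -comp_preimage (_ : _ \o _ = id)//; apply/funext => t /=; rewrite opprK addrK.
Qed.

Lemma lebesgue_opp (A : set V) : lo (-%R @^-1` A) = lo A.
Proof.
have H (B : set V) : (lo (-%R @^-1` B) <= lo B)%E.
  apply: (le_lebesgue_preimage (g := box_opp)) => -[[a b]|]//=.
    by move=> t /= ab i; move: (ab i); rewrite !mxE lerNl lerNr andbC.
  by apply: eq_bigr => i _; rewrite !mxE opprK addrC.
apply/eqP; rewrite eq_le H /=.
have := H (-%R @^-1` A).
by rewrite -comp_preimage (_ : _ \o _ = id)//; apply/funext => t /=; rewrite opprK.
Qed.

Lemma measurable_preserving (phi psi : V -> V) :
  cancel phi psi -> cancel psi phi -> (forall A, lo (phi @^-1` A) = lo A) ->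
  measurable_fun setT (phi : euclid R n -> euclid R n).
Proof.
move=> phiK psiK H _ A mA; rewrite setTI; change (lo.-caratheodory (phi @^-1` A)) => X.
have EX : X = phi @^-1` (psi @^-1` X).
  by rewrite -comp_preimage (_ : psi \o phi = id)//; apply/funext.
have -> : lo X = lo (psi @^-1` X) by rewrite {1}EX H.
have -> : X `&` phi @^-1` A = phi @^-1` (psi @^-1` X `&` A).
  by rewrite preimage_setI -EX.
have -> : X `&` ~` (phi @^-1` A) = phi @^-1` (psi @^-1` X `&` ~` A).
  by rewrite preimage_setI -EX.
by rewrite !H; exact: mA.
Qed.

Lemma measurable_shift (x : V) :
  measurable_fun setT ((fun t => t - x) : euclid R n -> euclid R n).
Proof.
apply: (measurable_preserving (psi := fun t => t + x)); last exact: lebesgue_shift.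
- exact: subrK.
- exact: addrK.
Qed.

Lemma measurable_opp : measurable_fun setT ((fun t : V => - t) : euclid R n -> euclid R n).
Proof.
by apply: (measurable_preserving (psi := -%R)); [exact: opprK|exact: opprK|exact: lebesgue_opp].
Qed.

Lemma measurable_coord (i : 'I_n) :
  measurable_fun setT (fun t : euclid R n => (t : V) ord0 i).
Proof.
apply: (measurability _ (RGenOInfty.measurableE R)) => //= _ [_ [c ->] <-].
rewrite setTI.
rewrite (_ : _ @^-1` _ = ~` [set t : V | t ord0 i <= c]); last first.
  by apply/seteqP; split => t /=; rewrite in_itv/= andbT ltNge => /negP.
apply: measurableC; apply: (le_caratheodory_measurable (mu := lo)) => X.
pose lowb (B : box n) : box n := omap (fun ab : V * V =>
  (ab.1, \row_j (if j == i then Num.min (ab.2 ord0 i) c else ab.2 ord0 j))) B.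
pose upb (B : box n) : box n := omap (fun ab : V * V =>
  (\row_j (if j == i then Num.max (ab.1 ord0 i) c else ab.1 ord0 j), ab.2)) B.
have volD B : box_vol B = box_vol (lowb B) + box_vol (upb B).
  case: B => [[a b]|]/=; last by rewrite addr0.
  rewrite (bigD1 i)//= [X in _ = X + _](bigD1 i)//= [X in _ = _ + X](bigD1 i)//=.
  rewrite !mxE eqxx.
  rewrite [X in _ = _ * X + _](eq_bigr (fun j => Num.max 0 (b ord0 j - a ord0 j))); last first.
    by move=> j /negbTE ji; rewrite !mxE ji.
  rewrite [X in _ = _ + _ * X](eq_bigr (fun j => Num.max 0 (b ord0 j - a ord0 j))); last first.
    by move=> j /negbTE ji; rewrite !mxE ji.
  rewrite -mulrDl; congr (_ * _).
  set u := a ord0 i; set v := b ord0 i; rewrite /Num.max /Num.min.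
  by repeat case: ifPn; rewrite -?leNgt => *; lra.
apply: le_ereal_inf_tmp => _ [F XF <-].
rewrite (eq_eseriesr (g := fun k => (box_vol (lowb (F k)))%:E + (box_vol (upb (F k)))%:E)%E); last first.
  by move=> k _; rewrite volD EFinD.
rewrite nneseriesD; [|by move=> *; rewrite lee_fin box_vol_ge0..].
apply: leeD; apply: ereal_inf_lbound.
- exists (lowb \o F) => // t [/XF[k _ Fk] tc]; exists k => //=.
  case: (F k) Fk => [[a b]|]//= ab j; move: (ab j); rewrite mxE.
  by case: eqP => // -> /andP[-> /=]; rewrite le_min => ->.
- exists (upb \o F) => // t [/XF[k _ Fk] tc]; exists k => //=.
  case: (F k) Fk => [[a b]|]//= ab j; move: (ab j); rewrite mxE.
  case: eqP => // -> /andP[ai ->]; rewrite ge_max ai andbT /=.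
  by move/negP: tc; rewrite -ltNge => /ltW.
Qed.

End lebesgue_rn_theory.

Section complex_L2.
Context d (T : measurableType d) (R : realType).
Variable mu : {measure set T -> \bar R}.
Local Notation C := R[i].

Definition cmeasurable (f : T -> C) : Prop :=
  measurable_fun setT (fun x => complex.Re (f x)) /\
  measurable_fun setT (fun x => complex.Im (f x)).

Definition sqintegrable (f : T -> C) : Prop :=
  cmeasurable f /\ (\int[mu]_x ((Normc.normc (f x)) ^+ 2)%:E < +oo)%E.

Definition cintegral (f : T -> C) : C :=
  Complex (\int[mu]_x complex.Re (f x)) (\int[mu]_x complex.Im (f x)).

Lemma normc_sqr (z : C) : Normc.normc z ^+ 2 = complex.Re z ^+ 2 + complex.Im z ^+ 2.
Proof. by case: z => a b /=; rewrite sqr_sqrtr// addr_ge0// sqr_ge0. Qed.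

Lemma cmeasurable_normc_sqr (f : T -> C) : cmeasurable f ->
  measurable_fun setT (fun x => ((Normc.normc (f x)) ^+ 2)%:E).
Proof.
move=> [mre mim]; apply/measurable_EFinP.
under eq_fun do rewrite normc_sqr.
by apply: measurable_funD; exact: measurable_funX.
Qed.

Lemma cmeasurableM (f g : T -> C) : cmeasurable f -> cmeasurable g ->
  cmeasurable (fun x => f x * g x).
Proof.
move=> [rf if_] [rg ig]; split.
  rewrite (_ : (fun _ => _) = (fun x => complex.Re (f x) * complex.Re (g x)
      - complex.Im (f x) * complex.Im (g x))); last first.
    by apply/funext => x; case: (f x) => a b; case: (g x).
  by apply: measurable_funB; exact: measurable_funM.
rewrite (_ : (fun _ => _) = (fun x => complex.Re (f x) * complex.Im (g x)
    + complex.Im (f x) * complex.Re (g x))); last first.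
  by apply/funext => x; case: (f x) => a b; case: (g x).
by apply: measurable_funD; exact: measurable_funM.
Qed.

Definition sqint_pred : {pred T -> C} := mem [set f | sqintegrable f].

Lemma sqintegrable_submod : submod_closed sqint_pred.
Proof.
split.
  rewrite inE /=; split; first by split; exact: measurable_cst.
  rewrite (eq_integral (cst 0%E)) ?integral0// => x _.
  by rewrite normc_sqr/= expr0n addr0.
move=> c f g; rewrite !inE /= => -[mf lf] [mg lg].
have mcf : cmeasurable (c *: f).
  by apply: (@cmeasurableM (cst c) f) => //; split; exact: measurable_cst.
have mh : cmeasurable (c *: f + g).
  split.
    rewrite (_ : (fun _ => _) = (fun x => complex.Re ((c *: f) x) + complex.Re (g x))).
      by apply: measurable_funD; [case: mcf|case: mg].
    by apply/funext => x; rewrite raddfD.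
  rewrite (_ : (fun _ => _) = (fun x => complex.Im ((c *: f) x) + complex.Im (g x))).
    by apply: measurable_funD; [case: mcf|case: mg].
  by apply/funext => x; rewrite raddfD.
split=> //.
pose k := 2 * Normc.normc c ^+ 2.
have k0 : 0 <= k by rewrite mulr_ge0// sqr_ge0.
have mf2 := cmeasurable_normc_sqr mf; have mg2 := cmeasurable_normc_sqr mg.
pose F := fun x => (Normc.normc (f x) ^+ 2)%:E.
pose G := fun x => (Normc.normc (g x) ^+ 2)%:E.
have F0 x : (0 <= F x)%E by rewrite lee_fin sqr_ge0.
have G0 x : (0 <= G x)%E by rewrite lee_fin sqr_ge0.
have kF0 x : (0 <= k%:E * F x)%E by rewrite mule_ge0.
have kG0 x : (0 <= 2%:E * G x)%E by rewrite mule_ge0.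
have mkF : measurable_fun setT (fun x => (k%:E * F x)%E) by exact: measurable_funeM.
have mkG : measurable_fun setT (fun x => (2%:E * G x)%E) by exact: measurable_funeM.
apply: (@le_lt_trans _ _ (\int[mu]_x (k%:E * F x + 2%:E * G x))%E).
  apply: ge0_le_integral => //.
  - by move=> x _; rewrite lee_fin sqr_ge0.
  - exact: cmeasurable_normc_sqr.
  - exact: emeasurable_funD.
  - move=> x _; rewrite -!EFinM -EFinD lee_fin /k -mulrA -exprMn -Normc.normcM.
    rewrite !normc_sqr /= fctE; set z := c * f x; rewrite (_ : (c *: f) x = z)//.
    case: z => a b; case: (g x) => u v /=.
    by have := sqr_ge0 (a - u); have := sqr_ge0 (b - v); rewrite !expr2; lra.
rewrite ge0_integralD// !ge0_integralZl//; try by rewrite lee_fin.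
by rewrite lte_add_pinfty// lte_mul_pinfty.
Qed.

HB.instance Definition _ :=
  GRing.isSubmodClosed.Build C (T -> C) sqint_pred sqintegrable_submod.

Record sqfun := Sqfun { sqfun_val :> T -> C; _ : sqfun_val \in sqint_pred }.
HB.instance Definition _ := [isSub for sqfun_val].
HB.instance Definition _ := [Choice of sqfun by <:].
HB.instance Definition _ := [SubChoice_isSubLmodule of sqfun by <:].

Definition sqfun_null : {pred sqfun} :=
  mem [set f : sqfun | \forall x \ae mu, f x = 0].

Lemma sqfun_null_submod : submod_closed sqfun_null.
Proof.
split; first by rewrite inE /=; exact: aeW.
move=> c f g; rewrite !inE /= => f0 g0; near=> x.
rewrite (_ : _ x = c * f x + g x)//.
by rewrite (near f0 x)// (near g0 x)// mulr0 addr0.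
Unshelve. all: by end_near. Qed.

HB.instance Definition _ :=
  GRing.isSubmodClosed.Build C sqfun sqfun_null sqfun_null_submod.

Definition L2 : Type := Quotient.quot sqfun_null.
HB.instance Definition _ := EqQuotient.on L2.
HB.instance Definition _ := GRing.Zmodule.on L2.

Definition L2_class (f : sqfun) : L2 := \pi_L2%qT f.

Lemma L2_classP (f g : sqfun) :
  L2_class f = L2_class g <-> \forall x \ae mu, f x = g x.
Proof.
rewrite /L2_class; split => [/eqP|] fg.
  move: fg; rewrite -Quotient.idealrBE inE /=; apply: filterS => x /=.
  by move=> /eqP; rewrite subr_eq0 => /eqP.
apply/eqP; rewrite -Quotient.idealrBE inE /=; apply: filterS fg => x fg.
by rewrite (_ : _ x = f x - g x)// fg subrr.
Qed.

Lemma L2_classD (f g : sqfun) : L2_class (f + g) = L2_class f + L2_class g.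
Proof. exact: (Quotient.pi_add sqfun_null f g). Qed.

Lemma L2_class_repr (u : L2) : L2_class (repr u) = u.
Proof. exact: reprK. Qed.

Definition L2_scale (c : C) (u : L2) : L2 := L2_class (c *: (repr u : sqfun)).

Lemma L2_scaleE c (f : sqfun) : L2_scale c (L2_class f) = L2_class (c *: f).
Proof.
apply/L2_classP; have /L2_classP := L2_class_repr (L2_class f).
apply: filterS => x fx; rewrite (_ : _ x = c * repr (L2_class f) x)// fx.
by [].
Qed.

Let scaleA a b v : L2_scale a (L2_scale b v) = L2_scale (a * b) v.
Proof. by rewrite -(L2_class_repr v) !L2_scaleE scalerA. Qed.

Let scale1 : left_id 1 L2_scale.
Proof. by move=> v; rewrite -(L2_class_repr v) L2_scaleE scale1r. Qed.

Let scaleDr : right_distributive L2_scale +%R.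
Proof.
move=> a u v; rewrite -(L2_class_repr u) -(L2_class_repr v).
by rewrite -L2_classD !L2_scaleE scalerDr L2_classD.
Qed.

Let scaleDl v : {morph L2_scale^~ v : a b / a + b}.
Proof.
by move=> a b; rewrite -(L2_class_repr v) !L2_scaleE scalerDl L2_classD.
Qed.

HB.instance Definition _ := GRing.Zmodule_isLmodule.Build C L2
  scaleA scale1 scaleDr scaleDl.

Definition L2_fun (u : L2) : T -> C := (repr u : sqfun).

(* The class of f; 0 if f is not square integrable. *)
Definition to_L2 (f : T -> C) : L2 :=
  if pselect (f \in sqint_pred) is left fP then L2_class (Sqfun fP) else 0.

Lemma L2_fun_sqintegrable (u : L2) : sqintegrable (L2_fun u).
Proof. by rewrite /L2_fun; case: (repr u) => f /=; rewrite inE. Qed.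

Lemma to_L2K (f : T -> C) : sqintegrable f ->
  \forall x \ae mu, L2_fun (to_L2 f) x = f x.
Proof.
move=> hf; rewrite /to_L2; case: pselect => [fP|]; last by rewrite inE.
by have /L2_classP := L2_class_repr (L2_class (Sqfun fP)).
Qed.

Definition inner (u v : L2) : C :=
  cintegral (fun x => L2_fun u x * conjc (L2_fun v x)).

Definition L2_norm (u : L2) : R := Num.sqrt (complex.Re (inner u u)).

Definition bounded_op (A : L2 -> L2) : Prop :=
  exists M : R, forall u, L2_norm (A u) <= M * L2_norm u.

Definition op_norm (A : L2 -> L2) : R :=
  sup [set L2_norm (A u) | u in [set u | L2_norm u <= 1]].

(* The adjoint is unique when it exists; bounded operators have one. *)
Definition adjoint (A : L2 -> L2) : L2 -> L2 :=
  xget (fun=> 0) [set B | forall u v, inner (A u) v = inner u (B v)].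

Definition rank_one (u v : L2) : L2 -> L2 := fun w => inner w v *: u.

Definition orthonormal_basis (e : nat -> L2) : Prop :=
  (forall i j, inner (e i) (e j) = (i == j)%:R) /\
  (forall u, (forall i, inner u (e i) = 0) -> u = 0).

(* Meaningful for trace class A on an infinite-dimensional separable space,
   where the sum converges and does not depend on the basis. R[i]^o is R[i]
   with the topology of the modulus. *)
Definition trace (A : L2 -> L2) : C :=
  xget 0 [set c | exists2 e, orthonormal_basis e &
    series (fun k => inner (A (e k)) (e k) : C^o) @ \oo --> (c : C^o)].

End complex_L2.
Arguments L2_norm {d T R mu} u.

Section time_frequency.
Context {R : realType} {d : nat}.
Local Notation C := R[i].
Local Notation V := 'rV[R]_d.
Local Notation E := (euclid R d).
Local Notation H := (L2 (lebesgue R d)).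
Local Notation phase_space := (euclid R (d + d)).

Definition dotp (x y : V) : R := \sum_(i < d) x ord0 i * y ord0 i.

Definition cexp_i (theta : R) : C := Complex (cos theta) (sin theta).

Definition position (z : phase_space) : V := lsubmx (z : 'rV[R]_(d + d)).
Definition frequency (z : phase_space) : V := rsubmx (z : 'rV[R]_(d + d)).

Definition tf_fun (z : phase_space) (f : E -> C) : E -> C :=
  fun t : V => cexp_i (2 * pi * dotp (frequency z) t) * f (t - position z).

Definition reflect_fun (f : E -> C) : E -> C := fun t : V => f (- t).

(* By [sqintegrable_tf] and [sqintegrable_reflect] below, the default value of
   [to_L2] is never used in [tf_shift] and [parity]. *)
Definition tf_shift (z : phase_space) (u : H) : H :=
  to_L2 (lebesgue R d) (tf_fun z (L2_fun u)).

Definition parity (u : H) : H := to_L2 (lebesgue R d) (reflect_fun (L2_fun u)).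

Lemma sqintegrable_preserving (phi : V -> V) (f : E -> C) :
  measurable_fun setT (phi : E -> E) ->
  (forall A, lebesgue_outer (phi @^-1` A) = lebesgue_outer A) ->
  sqintegrable (lebesgue R d) f ->
  sqintegrable (lebesgue R d) (fun t => f (phi t)).
Proof.
move=> mphi phiE [[mre mim] fi]; split.
  by split; [exact: (measurableT_comp mre mphi)|exact: (measurableT_comp mim mphi)].
rewrite (_ : \int[_]_x _ =
    \int[lebesgue R d]_x (Normc.normc (f x) ^+ 2)%:E)%E//.
have mf : measurable_fun setT (fun x => ((Normc.normc (f x)) ^+ 2)%:E).
  exact: cmeasurable_normc_sqr.
transitivity (\int[pushforward (lebesgue R d) (phi : E -> E)]_x (Normc.normc (f x) ^+ 2)%:E)%E.
  by rewrite ge0_integral_pushforward// => x _; rewrite lee_fin sqr_ge0.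
apply: eq_measure_integral => A mA _; exact: phiE.
Qed.

Lemma sqintegrable_reflect (f : E -> C) :
  sqintegrable (lebesgue R d) f -> sqintegrable (lebesgue R d) (reflect_fun f).
Proof.
apply: (sqintegrable_preserving (phi := fun t => - t)).
- exact: measurable_opp.
- exact: lebesgue_opp.
Qed.

Lemma measurable_dotp (w : V) : measurable_fun setT (fun t : E => dotp w t).
Proof.
rewrite /dotp.
apply: measurable_sum => i; apply: measurable_funM => //.
exact: measurable_coord.
Qed.

Lemma sqintegrable_tf (z : phase_space) (f : E -> C) :
  sqintegrable (lebesgue R d) f -> sqintegrable (lebesgue R d) (tf_fun z f).
Proof.
move=> hf.
have [mg ig] : sqintegrable (lebesgue R d) (fun t => f ((t : V) - position z)).
  apply: (sqintegrable_preserving (phi := fun t => t - position z)) => //.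
  - exact: measurable_shift.
  - exact: lebesgue_shift.
have mdot := measurable_dotp (frequency z).
have mtheta : measurable_fun setT (fun t : E => 2 * pi * dotp (frequency z) t).
  exact: measurable_funM.
split.
  apply: cmeasurableM mg; split => /=.
  - by apply: measurableT_comp mtheta; apply: continuous_measurable_fun; exact: continuous_cos.
  - by apply: measurableT_comp mtheta; apply: continuous_measurable_fun; exact: continuous_sin.
apply: le_lt_trans ig; rewrite le_eqVlt; apply/orP; left; apply/eqP.
apply: eq_integral => t _; rewrite /tf_fun Normc.normcM exprMn.
by rewrite [X in X * _]normc_sqr /= cos2Dsin2 mul1r.
Qed.

Definition check_op (A : H -> H) : H -> H := parity \o A \o parity.

Definition alpha (z : phase_space) (A : H -> H) : H -> H :=
  tf_shift z \o A \o adjoint (tf_shift z).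

Definition op_conv (B A : H -> H) (z : phase_space) : C :=
  trace (B \o alpha z (check_op A)).

Definition cohen (S : H -> H) (psi : H) : phase_space -> C :=
  op_conv (rank_one psi psi) S.

End time_frequency.

(* Main.v *)
(* Pointwise |Q_S(psi)(z)| <= ||S|| |psi|^2, so the integral over Omega is at most
   ||S|| mu(Omega), and ||S|| > 0 can be cancelled. For the pointwise bound put
   B = alpha_z(check S), which is linear with ||B|| <= ||S|| since parity and the
   time-frequency shifts are isometries and the adjoint of an isometry is a
   contraction. The n-th partial sum of the trace of w |-> <B w, psi> psi in an
   orthonormal system is <B p, psi>, where p is the projection of psi onto the first
   n vectors, so Bessel's and the Cauchy-Schwarz inequalities bound it uniformly in
   n. Neither the existence of adjoints nor the convergence of the trace has to be
   proved: where they fail, the definitions return 0, which satisfies the bound. *)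
Require Import Defs.
From mathcomp Require Import all_boot all_order all_algebra.
From mathcomp Require Import complex.
From mathcomp Require Import all_classical all_reals all_analysis.
From mathcomp Require Import measurable_realfun lra.

Set Implicit Arguments.
Unset Strict Implicit.
Unset Printing Implicit Defensive.

Import Order.TTheory GRing.Theory Num.Theory.
Import numFieldNormedType.Exports.
Local Open Scope classical_set_scope.
Local Open Scope ring_scope.

(** * Integrals of complex-valued functions *)

Section L2_inner_product.
Context d (T : measurableType d) (R : realType).
Variable mu : {measure set T -> \bar R}.
Local Notation C := R[i].
Local Notation H := (L2 mu).
Implicit Types (f g F G : T -> C) (u v w : H) (a : C).

(** [cintegral] takes [fine] of the integrals of both components, so its linearity is derived from
    integrability of both. *)
Definition cintegrable F : Prop :=
  mu.-integrable setT (fun x => (complex.Re (F x))%:E) /\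
  mu.-integrable setT (fun x => (complex.Im (F x))%:E).

Lemma cmeasurable_conj f : cmeasurable f -> cmeasurable (fun x => conjc (f x)).
Proof.
move=> [mr mi]; split.
  by rewrite (_ : (fun _ => _) = (fun x => complex.Re (f x)))//; apply/funext => x; case: (f x).
rewrite (_ : (fun _ => _) = (fun x => - complex.Im (f x))).
  exact: measurableT_comp.
by apply/funext => x; case: (f x).
Qed.

(** Both components of the product are at most |f|^2 + |g|^2 in absolute value. *)
Lemma cintegrable_mul_conj f g : sqintegrable mu f -> sqintegrable mu g ->
  cintegrable (fun x => f x * conjc (g x)).
Proof.
move=> [mf fi] [mg gi].
have int h : cmeasurable h ->
    (\int[mu]_x (Normc.normc (h x) ^+ 2)%:E < +oo)%E ->
    mu.-integrable setT (fun x => (Normc.normc (h x) ^+ 2)%:E).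
  move=> mh hi; apply/integrableP; split; first exact: cmeasurable_normc_sqr.
  by under eq_integral do rewrite gee0_abs ?lee_fin ?sqr_ge0//.
have fgi := integrableD measurableT (int _ mf fi) (int _ mg gi).
have [mr mi] := cmeasurableM mf (cmeasurable_conj mg).
split; apply: (le_integrable measurableT _ _ fgi); try exact/measurable_EFinP.
- move=> x _; rewrite /= lee_fin [leRHS]ger0_norm ?addr_ge0 ?sqr_ge0// !normc_sqr.
  case: (f x) (g x) => p q [s t] /=; rewrite ler_norml.
  have := sqr_ge0 (p - s); have := sqr_ge0 (p + s).
  have := sqr_ge0 (q - t); have := sqr_ge0 (q + t).
  have := sqr_ge0 p; have := sqr_ge0 s; have := sqr_ge0 q; have := sqr_ge0 t.
  by rewrite !expr2 => *; apply/andP; split; lra.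
- move=> x _; rewrite /= lee_fin [leRHS]ger0_norm ?addr_ge0 ?sqr_ge0// !normc_sqr.
  case: (f x) (g x) => p q [s t] /=; rewrite ler_norml.
  have := sqr_ge0 (p - t); have := sqr_ge0 (p + t).
  have := sqr_ge0 (q - s); have := sqr_ge0 (q + s).
  have := sqr_ge0 p; have := sqr_ge0 s; have := sqr_ge0 q; have := sqr_ge0 t.
  by rewrite !expr2 => *; apply/andP; split; lra.
Qed.

Lemma cintegral_linear a F G : cintegrable F -> cintegrable G ->
  cintegral mu (fun x => a * F x + G x) = a * cintegral mu F + cintegral mu G.
Proof.
move=> [Fr Fi] [Gr Gi]; case: a => p q.
have iZ (r : R) (h : T -> R) : mu.-integrable setT (EFin \o h) ->
    mu.-integrable setT (EFin \o (fun x => r * h x)).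
  by move=> hi; exact: (integrableZl measurableT r hi).
have iD (h k : T -> R) : mu.-integrable setT (EFin \o h) ->
    mu.-integrable setT (EFin \o k) ->
    mu.-integrable setT (EFin \o (fun x => h x + k x)).
  by move=> hi ki; exact: (integrableD measurableT hi ki).
rewrite /cintegral; congr Complex.
  transitivity (\int[mu]_x (p * complex.Re (F x) + (- q) * complex.Im (F x)
      + complex.Re (G x))).
    by apply: eq_Rintegral => x _; case: (F x) (G x) => ? ? [] /= *; rewrite mulNr.
  rewrite !RintegralD ?RintegralZl ?mulNr//; do ?[exact: iZ|exact: iD].
  by apply: iD; exact: iZ.
transitivity (\int[mu]_x (p * complex.Im (F x) + q * complex.Re (F x)
    + complex.Im (G x))).
  by apply: eq_Rintegral => x _; case: (F x) (G x) => ? ? [] /=.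
rewrite !RintegralD ?RintegralZl//; do ?[exact: iZ|exact: iD].
by apply: iD; exact: iZ.
Qed.

Lemma ae_eq_cintegral F G : cmeasurable F -> cmeasurable G ->
  (\forall x \ae mu, F x = G x) -> cintegral mu F = cintegral mu G.
Proof.
move=> [Fr Fi] [Gr Gi] FG; rewrite /cintegral /Rintegral.
by congr Complex; congr fine; apply: ae_eq_integral => //;
  do ?[exact/measurable_EFinP]; apply: filterS FG => x ->.
Qed.

(** * Inner product and norm of square integrable classes *)

Lemma L2_fun_cmeasurable u : cmeasurable (L2_fun u).
Proof. by case: (L2_fun_sqintegrable u). Qed.

(** [inner] is defined through chosen representatives; this allows computing with other measurable
    ones. *)
Lemma innerE u v f g : cmeasurable f -> cmeasurable g ->
  (\forall x \ae mu, L2_fun u x = f x) -> (\forall x \ae mu, L2_fun v x = g x) ->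
  inner u v = cintegral mu (fun x => f x * conjc (g x)).
Proof.
move=> mf mg uf vg; apply: ae_eq_cintegral.
- by apply: cmeasurableM (cmeasurable_conj _); exact: L2_fun_cmeasurable.
- by apply: cmeasurableM (cmeasurable_conj _).
- by apply: filterS2 uf vg => x -> ->.
Qed.

(** Both sides represent the same class, but the left one is an arbitrary choice, hence only almost
    everywhere. *)
Lemma L2_fun_linear a u v :
  \forall x \ae mu, L2_fun (a *: u + v) x = a * L2_fun u x + L2_fun v x.
Proof.
have -> : a *: u + v = L2_class (a *: (repr u : sqfun mu) + repr v).
  by rewrite L2_classD -[X in _ = _ + X]/(L2_class (repr v)) L2_class_repr.
by have /L2_classP := L2_class_repr (L2_class (a *: (repr u : sqfun mu) + repr v)).
Qed.

Lemma eq_L2 u v : (\forall x \ae mu, L2_fun u x = L2_fun v x) -> u = v.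
Proof.
by move=> uv; rewrite -(L2_class_repr u) -(L2_class_repr v); apply/L2_classP.
Qed.

Lemma inner_linear a u v w : inner (a *: u + v) w = a * inner u w + inner v w.
Proof.
rewrite (innerE _ (L2_fun_cmeasurable w) (L2_fun_linear a u v)) //; last 2 first.
- have [mr mi] := L2_fun_cmeasurable v.
  have [nr ni] : cmeasurable (fun x => a * L2_fun u x).
    apply: cmeasurableM (L2_fun_cmeasurable u).
    by split; exact: measurable_cst.
  split.
    by under eq_fun do rewrite raddfD; exact: measurable_funD.
  by under eq_fun do rewrite raddfD; exact: measurable_funD.
- exact: aeW.
rewrite /inner -cintegral_linear; last 2 first.
- by apply: cintegrable_mul_conj; exact: L2_fun_sqintegrable.
- by apply: cintegrable_mul_conj; exact: L2_fun_sqintegrable.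
by congr cintegral; apply/funext => x; rewrite mulrDl mulrA.
Qed.

Lemma inner_conj u v : inner v u = conjc (inner u v).
Proof.
rewrite /inner /cintegral /=; congr Complex.
  by apply: eq_Rintegral => x _; case: (L2_fun u x) (L2_fun v x) => ? ? [? ?] /=; lra.
have [_ uvi] := cintegrable_mul_conj (L2_fun_sqintegrable u) (L2_fun_sqintegrable v).
rewrite -mulN1r -RintegralZl//.
by apply: eq_Rintegral => x _; case: (L2_fun u x) (L2_fun v x) => ? ? [? ?] /=; lra.
Qed.

Lemma L2_norm_ge0 u : 0 <= L2_norm u.
Proof. exact: sqrtr_ge0. Qed.

Lemma Re_inner_self u :
  complex.Re (inner u u) = \int[mu]_x (Normc.normc (L2_fun u x) ^+ 2).
Proof.
by apply: eq_Rintegral => x _; rewrite normc_sqr; case: (L2_fun u x) => ? ? /=; lra.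
Qed.

(** Square integrability makes the integral finite, so the [fine] hidden in [inner] loses nothing,
    and results on extended integrals apply to the norm. *)
Lemma L2_norm_sqr u :
  ((L2_norm u ^+ 2)%:E = \int[mu]_x (Normc.normc (L2_fun u x) ^+ 2)%:E)%E.
Proof.
have [mu2 ui] := L2_fun_sqintegrable u.
have i0 : (0 <= \int[mu]_x (Normc.normc (L2_fun u x) ^+ 2)%:E)%E.
  by apply: integral_ge0 => x _; rewrite lee_fin sqr_ge0.
rewrite /L2_norm Re_inner_self sqr_sqrtr ?fine_ge0//.
by rewrite fineK// ge0_fin_numE.
Qed.

Lemma inner_self u : inner u u = (L2_norm u ^+ 2)%:C%C.
Proof.
have /(congr1 fine)/= -> := L2_norm_sqr u.
apply/eqP; rewrite eq_complex Re_inner_self eqxx /=; apply/eqP.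
rewrite /Rintegral (integral0_eq)//.
by move=> x _; congr EFin; case: (L2_fun u x) => ? ? /=; lra.
Qed.

Lemma L2_norm_eq0 u : L2_norm u = 0 -> u = 0.
Proof.
move=> u0; have := L2_norm_sqr u; rewrite u0 expr0n/= => /esym i0.
have mu2 := cmeasurable_normc_sqr (L2_fun_cmeasurable u).
have : (\int[mu]_x `|(Normc.normc (L2_fun u x) ^+ 2)%:E| = 0)%E.
  by rewrite -[RHS]i0; apply: eq_integral => x _; rewrite gee0_abs ?lee_fin ?sqr_ge0.
move/(ae_eq_integral_abs _ measurableT mu2) => {}u0.
(* The chosen representative of the class 0 vanishes almost everywhere; this is read off from -u + u
   = 0. *)
have z : \forall x \ae mu, L2_fun (0 : H) x = 0.
  have := L2_fun_linear (-1) u u; rewrite scaleN1r addNr.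
  by apply: filterS => x ->; rewrite mulN1r addNr.
apply: eq_L2; apply: filterS2 z u0 => x -> /(_ I) /eqP.
by rewrite /= eqe sqrf_eq0 => /eqP /Normc.eq0_normc.
Qed.

(* [rmorphM] and [rmorphD] followed by simplification would unfold [inner] under [conjc]. *)
Let conjM (a b : C) : conjc (a * b) = conjc a * conjc b.
Proof. exact: rmorphM. Qed.

Let conjD (a b : C) : conjc (a + b) = conjc a + conjc b.
Proof. exact: rmorphD. Qed.

Let conjB (a b : C) : conjc (a - b) = conjc a - conjc b.
Proof. exact: rmorphB. Qed.

Lemma inner0l w : inner 0 w = 0.
Proof. by have := inner_linear (-1) w w w; rewrite scaleN1r addNr mulN1r addNr. Qed.

Lemma innerDl u v w : inner (u + v) w = inner u w + inner v w.
Proof. by have := inner_linear 1 u v w; rewrite scale1r mul1r. Qed.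

Lemma innerZl a u w : inner (a *: u) w = a * inner u w.
Proof. by have := inner_linear a u 0 w; rewrite addr0 inner0l addr0. Qed.

Lemma innerBl u v w : inner (u - v) w = inner u w - inner v w.
Proof. by rewrite innerDl -scaleN1r innerZl mulN1r. Qed.

Lemma innerZr a u w : inner u (a *: w) = conjc a * inner u w.
Proof. by rewrite inner_conj innerZl conjM -inner_conj. Qed.

Lemma innerDr u v w : inner w (u + v) = inner w u + inner w v.
Proof. by rewrite inner_conj innerDl conjD -!inner_conj. Qed.

Lemma innerBr u v w : inner w (u - v) = inner w u - inner w v.
Proof. by rewrite inner_conj innerBl conjB -!inner_conj. Qed.

Lemma inner_suml I (s : seq I) (P : pred I) (F : I -> H) w :
  inner (\sum_(i <- s | P i) F i) w = \sum_(i <- s | P i) inner (F i) w.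
Proof.
by elim/big_rec2: _ => [|i x y _ <-]; [exact: inner0l|rewrite innerDl].
Qed.

Lemma inner_sumr I (s : seq I) (P : pred I) (F : I -> H) w :
  inner w (\sum_(i <- s | P i) F i) = \sum_(i <- s | P i) inner w (F i).
Proof.
rewrite inner_conj inner_suml (big_morph _ conjD (conjc0 _)).
by apply: eq_bigr => i _; rewrite -inner_conj.
Qed.

Lemma normc_ge0 (z : C) : 0 <= Normc.normc z.
Proof. by case: z => x y; exact: sqrtr_ge0. Qed.

Lemma normc_real (r : R) : Normc.normc (r%:C)%C = `|r|.
Proof. by rewrite /= expr0n addr0 sqrtr_sqr. Qed.

Lemma normr_normc (z : C) : `|z| = (Normc.normc z)%:C%C.
Proof. by rewrite normc_def; case: z. Qed.

Lemma mul_conj (z : C) : z * conjc z = (Normc.normc z ^+ 2)%:C%C.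
Proof.
rewrite normc_sqr; case: z => x y; apply/eqP; rewrite eq_complex /=.
by apply/andP; split; apply/eqP; lra.
Qed.

Lemma L2_normZ a u : L2_norm (a *: u) = Normc.normc a * L2_norm u.
Proof.
apply/eqP; rewrite -(eqrXn2 (n := 2)) ?mulr_ge0 ?normc_ge0 ?L2_norm_ge0//.
apply/eqP/complexI; rewrite -inner_self innerZl innerZr inner_self mulrA mul_conj.
by rewrite exprMn; apply/eqP; rewrite eq_complex /= !(mulr0, mul0r, subr0, addr0) !eqxx.
Qed.

Lemma L2_norm0 : L2_norm (0 : H) = 0.
Proof. by rewrite -(scale0r 0) L2_normZ /= expr0n /= addr0 sqrtr0 mul0r. Qed.

(** * Cauchy-Schwarz and Bessel inequalities *)

Lemma inner_CauchySchwarz u v : Normc.normc (inner u v) <= L2_norm u * L2_norm v.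
Proof.
have [v0|v0] := eqVneq (L2_norm v) 0.
  by rewrite (L2_norm_eq0 v0) inner_conj inner0l conjc0 /= expr0n /= addr0 sqrtr0
    mulr_ge0 ?L2_norm_ge0.
have v_gt0 : 0 < L2_norm v by rewrite lt_def v0 L2_norm_ge0.
(* [|v|^2 u - <u,v> v] has squared norm [|v|^2 (|u|^2 |v|^2 - |<u,v>|^2)]. *)
pose w := (L2_norm v ^+ 2)%:C%C *: u - inner u v *: v.
have ww : inner w w = (L2_norm v ^+ 2 *
    (L2_norm u ^+ 2 * L2_norm v ^+ 2 - Normc.normc (inner u v) ^+ 2))%:C%C.
  rewrite /w !(innerBl, innerBr, innerZl, innerZr) (inner_conj u v) !inner_self.
  rewrite normc_sqr; case: (inner u v) => x y; apply/eqP; rewrite eq_complex /=.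
  by apply/andP; split; apply/eqP; lra.
have : 0 <= L2_norm u ^+ 2 * L2_norm v ^+ 2 - Normc.normc (inner u v) ^+ 2.
  rewrite -(pmulr_rge0 _ (exprn_gt0 2 v_gt0)) -(complex.ler0c) -ww inner_self.
  by rewrite complex.ler0c sqr_ge0.
rewrite subr_ge0 -exprMn ler_sqr ?nnegrE ?mulr_ge0 ?L2_norm_ge0//.
exact: normc_ge0.
Qed.

(** The sum p is an orthogonal projection of u, so <p,p> = <u,p>, and Cauchy-Schwarz gives |p|^2 <=
    |u| |p|. *)
Lemma Bessel (e : nat -> H) u n : (forall i j, inner (e i) (e j) = (i == j)%:R) ->
  L2_norm (\sum_(k < n) inner u (e k) *: e k) <= L2_norm u.
Proof.
move=> e1; set p := \sum_(k < n) _.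
have pe (j : 'I_n) : inner p (e j) = inner u (e j).
  rewrite inner_suml (bigD1 j)//= innerZl e1 eqxx mulr1 big1 ?addr0// => i ij.
  by rewrite innerZl e1 (inj_eq val_inj) (negbTE ij) mulr0.
have pp : inner p p = inner u p.
  rewrite {2 3}/p !inner_sumr; apply: eq_bigr => i _.
  by rewrite !innerZr pe.
have := inner_CauchySchwarz u p; rewrite -pp inner_self normc_real ger0_norm ?sqr_ge0//.
have [->|p0] := eqVneq (L2_norm p) 0; first by rewrite L2_norm_ge0.
by rewrite expr2 ler_pM2r// lt_def p0 L2_norm_ge0.
Qed.

(** * Adjoints *)

Lemma eq_inner u v : (forall w, inner w u = inner w v) -> u = v.
Proof.
move=> uv; apply/eqP; rewrite -subr_eq0; apply/eqP/L2_norm_eq0/eqP.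
by rewrite -sqrf_eq0; apply/eqP/complexI; rewrite -inner_self innerBr uv subrr.
Qed.

Lemma adjointP (A : H -> H) :
  (forall u v, inner (A u) v = inner u (adjoint A v)) \/ adjoint A = (fun=> 0).
Proof. by rewrite /adjoint; case: xgetP => [B _ AB|_]; [left|right]. Qed.

(** The adjoint identity moves the operator to the first factor, where the second factor can be
    expanded; testing against every w suffices. The default zero map is linear too. *)
Lemma adjoint_linear (A : H -> H) : linear (adjoint A).
Proof.
have [AA|->] := adjointP A; last by move=> a u v; rewrite scaler0 addr0.
move=> a u v; apply: eq_inner => w.
by rewrite -AA innerDr innerZr !AA -innerZr -innerDr.
Qed.

(** With v the adjoint applied to u, |v|^2 = <A v, u> <= |v| |u|. *)
Lemma adjoint_contraction (A : H -> H) :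
  (forall u, L2_norm (A u) <= L2_norm u) ->
  forall u, L2_norm (adjoint A u) <= L2_norm u.
Proof.
move=> A1 u; have [AA|->] := adjointP A; last by rewrite L2_norm0 L2_norm_ge0.
set v := adjoint A u.
have : L2_norm v ^+ 2 <= L2_norm v * L2_norm u.
  have := inner_CauchySchwarz (A v) u; rewrite AA inner_self normc_real.
  rewrite ger0_norm ?sqr_ge0// => /le_trans; apply.
  by rewrite ler_wpM2r ?L2_norm_ge0.
have [->|v0] := eqVneq (L2_norm v) 0; first by rewrite L2_norm_ge0.
by rewrite expr2 ler_pM2l// lt_def v0 L2_norm_ge0.
Qed.

(** * Bounds on traces *)

Lemma normc_trace_le (A : H -> H) (M : R) : 0 <= M ->
  (forall e, orthonormal_basis e -> forall n,
    Normc.normc (\sum_(k < n) inner (A (e k)) (e k)) <= M) ->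
  Normc.normc (trace A) <= M.
Proof.
(* [xget] yields a limit along some unspecified basis, whence the assumption on all bases, or the
   default 0. *)
move=> M0 AM; rewrite /trace; case: xgetP => [c _|_]; last first.
  by rewrite /= expr0n /= addr0 sqrtr0.
move=> [e eb ec].
suff : `|c : C| <= (M%:C)%C by rewrite normr_normc complex.lecR.
(* For arbitrary r > 0, the limit is within r of a partial sum, whose modulus is at most M. *)
apply/ler_addgt0Pr => r r0; have /cvgrPdist_lt/(_ r r0)[n _ /(_ n (leqnn n))/ltW cn] := ec.
rewrite -(subrK (series (fun k => inner (A (e k)) (e k) : C^o) n) c).
rewrite (le_trans (ler_normD _ _))// [leRHS]addrC lerD//.
have := AM e eb n; rewrite -complex.lecR.
by rewrite /series /= big_mkord normr_normc.
Qed.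

Lemma normc_trace_rank_one_le (B : H -> H) (M : R) psi : linear B -> 0 <= M ->
  (forall u, L2_norm (B u) <= M * L2_norm u) ->
  Normc.normc (trace (rank_one psi psi \o B)) <= M * L2_norm psi ^+ 2.
Proof.
move=> Blin M0 BM; apply: normc_trace_le => [|e [e1 _] n].
  by rewrite mulr_ge0 ?sqr_ge0.
have B0 : B 0 = 0.
  by have := Blin (-1) 0 0; rewrite scaleN1r addNr => ->; rewrite scaleN1r addNr.
pose p := \sum_(k < n) inner psi (e k) *: e k.
(* Each term equals <psi, e_k> <B e_k, psi>; linearity collects the sum inside [B]. *)
have -> : \sum_(k < n) inner ((rank_one psi psi \o B) (e k)) (e k) = inner (B p) psi.
  have -> : B p = \sum_(k < n) inner psi (e k) *: B (e k).
    rewrite /p; elim/big_rec2: _ => [|k x y _ <-]; first exact: B0.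
    exact: Blin.
  rewrite inner_suml; apply: eq_bigr => k _.
  by rewrite /rank_one /= !innerZl mulrC.
apply: le_trans (inner_CauchySchwarz _ _) _.
rewrite expr2 mulrA ler_wpM2r ?L2_norm_ge0//.
by apply: le_trans (BM _) _; rewrite ler_wpM2l// Bessel.
Qed.

(** * Operator norm *)

Lemma op_norm_bound (S : {linear H -> H}) u : bounded_op S ->
  L2_norm (S u) <= op_norm S * L2_norm u.
Proof.
move=> [M SM]; have [u0|u0] := eqVneq (L2_norm u) 0.
  by rewrite (L2_norm_eq0 u0) linear0 L2_norm0 mulr0.
have u_gt0 : 0 < L2_norm u by rewrite lt_def u0 L2_norm_ge0.
rewrite -ler_pdivrMr// mulrC.
(* Rescaling u to norm one brings it into the unit ball of the supremum. *)
pose c := ((L2_norm u)^-1)%:C%C.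
have nc : Normc.normc c = (L2_norm u)^-1.
  by rewrite normc_real ger0_norm// invr_ge0 L2_norm_ge0.
rewrite -nc -L2_normZ -linearZ; apply: ub_le_sup.
  (* The absolute value is taken because the sign of [M] is unknown and |v| <= 1 is multiplied by
     it. *)
  exists (`|M|) => _ [v /= v1 <-]; apply: le_trans (SM _) _.
  apply: le_trans (ler_wpM2r (L2_norm_ge0 _) (ler_norm M)) _.
  by rewrite -[leRHS]mulr1 ler_wpM2l.
by exists (c *: u) => //=; rewrite L2_normZ nc mulVf.
Qed.

(** A nonzero S u has positive norm, which a nonpositive [op_norm S] could not dominate. *)
Lemma op_norm_gt0 (S : {linear H -> H}) : bounded_op S -> (exists u, S u != 0) ->
  0 < op_norm S.
Proof.
move=> Sb [u Su0]; have Su : 0 < L2_norm (S u).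
  by rewrite lt_def L2_norm_ge0 andbT; apply: contra Su0 => /eqP/L2_norm_eq0->.
rewrite ltNge; apply/negP => S0.
have := lt_le_trans Su (op_norm_bound u Sb).
by rewrite ltNge mulr_le0_ge0 ?L2_norm_ge0.
Qed.

End L2_inner_product.

(** * Weighted compositions with measure-preserving maps *)

Section weighted_composition.
Context d (T : measurableType d) (R : realType).
Variable mu : {measure set T -> \bar R}.
Local Notation C := R[i].
(** The common form of [tf_shift] (a phase times a translation) and [parity] (weight 1 and a
    reflection). *)
Variables (W : (T -> C) -> T -> C) (m : T -> C) (phi : T -> T).
Hypothesis WE : forall f t, W f t = m t * f (phi t).
Hypothesis m_unimodular : forall t, Normc.normc (m t) = 1.
Hypothesis phi_measurable : measurable_fun setT phi.
Hypothesis phi_preserving : forall A, measurable A -> mu (phi @^-1` A) = mu A.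
Hypothesis W_sqintegrable : forall f, sqintegrable mu f -> sqintegrable mu (W f).

Let ae_comp (P : set T) : (\forall x \ae mu, P x) -> \forall x \ae mu, P (phi x).
Proof.
move=> [N [mN N0 PN]]; exists (phi @^-1` N); split.
- by rewrite -[X in measurable X]setTI; exact: phi_measurable.
- by rewrite phi_preserving.
- by move=> x /= Px; exact: PN.
Qed.

Let WK (u : L2 mu) : \forall x \ae mu,
  L2_fun (to_L2 mu (W (L2_fun u))) x = m x * L2_fun u (phi x).
Proof.
have := to_L2K (W_sqintegrable (L2_fun_sqintegrable u)).
by apply: filterS => x ->; exact: WE.
Qed.

Lemma weighted_composition_linear : linear (fun u : L2 mu => to_L2 mu (W (L2_fun u))).
Proof.
move=> a u v; apply: eq_L2.
have lhs := L2_fun_linear a (to_L2 mu (W (L2_fun u))) (to_L2 mu (W (L2_fun v))).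
have W1 := WK (a *: u + v); have W2 := WK u; have W3 := WK v.
(* Linearity of representatives is needed at [phi x] for almost every x. *)
have uv := ae_comp (L2_fun_linear a u v).
near=> x.
rewrite (near lhs x)// (near W1 x)// (near W2 x)// (near W3 x)// (near uv x)//.
by rewrite mulrDr mulrCA.
Unshelve. all: by end_near. Qed.

Lemma weighted_composition_isometry (u : L2 mu) :
  L2_norm (to_L2 mu (W (L2_fun u))) = L2_norm u.
Proof.
have m2 (v : L2 mu) := cmeasurable_normc_sqr (L2_fun_cmeasurable v).
apply/eqP; rewrite -(eqrXn2 (n := 2)) ?L2_norm_ge0// -eqe !L2_norm_sqr; apply/eqP.
(* The unimodular weight drops out; a change of variables then removes [phi], whose image measure is
   [mu]. *)
transitivity (\int[mu]_x (Normc.normc (L2_fun u (phi x)) ^+ 2)%:E)%E.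
  apply: ae_eq_integral => //; first exact: (measurableT_comp (m2 u)).
  by apply: filterS (WK u) => x -> _; rewrite Normc.normcM m_unimodular mul1r.
transitivity (\int[pushforward mu phi]_x (Normc.normc (L2_fun u x) ^+ 2)%:E)%E.
  by rewrite ge0_integral_pushforward// => x _; rewrite lee_fin sqr_ge0.
by apply: eq_measure_integral => A mA _; exact: phi_preserving.
Qed.

End weighted_composition.

(** * Time-frequency shifts, parity and the pointwise bound *)

Section time_frequency_operators.
Context {R : realType} {d : nat}.
Local Notation H := (L2 (lebesgue R d)).

Let tf_fun_E (z : euclid R (d + d)) f t : tf_fun z f t =
  cexp_i (2 * pi * dotp (frequency z) t) * f ((t : 'rV[R]_d) - position z).
Proof. by []. Qed.

Let cexp_i_unimodular (theta : R) : Normc.normc (cexp_i theta) = 1.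
Proof. by rewrite /= cos2Dsin2 sqrtr1. Qed.

Lemma tf_shift_linear (z : euclid R (d + d)) : linear (tf_shift z : H -> H).
Proof.
apply: (weighted_composition_linear (tf_fun_E z)).
- exact: measurable_shift.
- by move=> A _; exact: lebesgue_shift.
- exact: sqintegrable_tf.
Qed.

Lemma tf_shift_isometry (z : euclid R (d + d)) (u : H) :
  L2_norm (tf_shift z u) = L2_norm u.
Proof.
apply: (weighted_composition_isometry (tf_fun_E z)).
- by move=> t; exact: cexp_i_unimodular.
- exact: measurable_shift.
- by move=> A _; exact: lebesgue_shift.
- exact: sqintegrable_tf.
Qed.

Let reflect_fun_E (f : euclid R d -> R[i]) t : reflect_fun f t = 1 * f (- (t : 'rV[R]_d)).
Proof. by rewrite mul1r. Qed.

Lemma parity_linear : linear (parity : H -> H).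
Proof.
apply: (weighted_composition_linear reflect_fun_E).
- exact: measurable_opp.
- by move=> A _; exact: lebesgue_opp.
- exact: sqintegrable_reflect.
Qed.

Lemma parity_isometry (u : H) : L2_norm (parity u) = L2_norm u.
Proof.
apply: (weighted_composition_isometry reflect_fun_E).
- by move=> t; exact: Normc.normc1.
- exact: measurable_opp.
- by move=> A _; exact: lebesgue_opp.
- exact: sqintegrable_reflect.
Qed.

Lemma normc_cohen_le (S : {linear H -> H}) (psi : H) (z : euclid R (d + d)) :
  bounded_op S -> 0 <= op_norm S ->
  Normc.normc (cohen S psi z) <= op_norm S * L2_norm psi ^+ 2.
Proof.
move=> Sb S0; apply: normc_trace_rank_one_le => // [a u v|u].
  rewrite /alpha /check_op /= adjoint_linear !parity_linear linearP.
  by rewrite parity_linear tf_shift_linear.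
(* From the outside inwards: the shift and parity preserve norms, S contributes [op_norm S], the
   inner parity preserves norms and the adjoint does not increase them. *)
rewrite /alpha /check_op /= tf_shift_isometry parity_isometry.
apply: le_trans (op_norm_bound _ Sb) _; rewrite ler_wpM2l// parity_isometry.
by apply: adjoint_contraction => v; rewrite tf_shift_isometry.
Qed.

End time_frequency_operators.

(* Unlike [ge0_le_integral], this needs no measurability: the integral of a nonnegative
   function is a supremum over the simple functions below it. It spares us the
   measurability of [cohen S psi]. *)
Lemma ge0_le_integral_nonmeasurable d (T : measurableType d) (R : realType)
    (mu : {measure set T -> \bar R}) (D : set T) (f g : T -> \bar R) :
  (forall x, D x -> 0 <= f x)%E -> (forall x, D x -> f x <= g x)%E ->
  (\int[mu]_(x in D) f x <= \int[mu]_(x in D) g x)%E.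
Proof.
move=> f0 fg; have g0 x : D x -> (0 <= g x)%E.
  by move=> Dx; exact: le_trans (f0 _ Dx) (fg _ Dx).
rewrite !ge0_integralE//; apply: ereal_sup_le => _ [h hf <-]; exists h => // x.
by apply: le_trans (hf x) _; rewrite !patchE; case: ifPn => // /set_mem; exact: fg.
Qed.

Theorem proposition7p7 (R : realType) (d : nat) (d_gt0 : (0 < d)%N)
    (S : {linear L2 (lebesgue R d) -> L2 (lebesgue R d)})
    (S_bounded : bounded_op S) (S_neq0 : exists u, S u != 0)
    (Omega : set (euclid R (d + d))) (mOmega : measurable Omega)
    (psi : L2 (lebesgue R d)) (psi1 : L2_norm psi = 1)
    (eps : R) (eps_ge0 : 0 <= eps)
    (concentration :
      (((1 - eps) * op_norm S)%:E <=
        \int[lebesgue R (d + d)]_(z in Omega)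
          (Normc.normc (cohen S psi z))%:E)%E) :
  ((1 - eps)%:E <= lebesgue R (d + d) Omega)%E.
Proof.
have S0 := op_norm_gt0 S_bounded S_neq0.
(* Multiplied by [op_norm S], the right-hand side becomes the integral of a constant over [Omega],
   so it suffices to compare integrands. *)
rewrite -(@lee_pmul2r _ (op_norm S)%:E)// -EFinM (le_trans concentration)//.
rewrite muleC -integral_cst//.
apply: ge0_le_integral_nonmeasurable => z _; rewrite lee_fin ?normc_ge0//.
by have := normc_cohen_le psi z S_bounded (ltW S0); rewrite psi1 expr1n mulr1.
Qed.
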